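(* Let $A$ be the set of integers $a\ge3$ for which there exists an infinite binary word with pseudoperiod $(1,a)$ that avoids $3^+$-powers. Then $A$ contains at least $85\%$ of all positive integers, in the sense that $\liminf_{N\to\infty}|A\cap\{1,\ldots,N\}|/N\ge 0.85$.
   Context: An infinite word $\mathbf{x}$ (indexed from $0$) has pseudoperiod $(1,a)$ if $\mathbf{x}[i]\in\{\mathbf{x}[i+1],\mathbf{x}[i+a]\}$ for all $i\ge0$. The exponent of a nonempty finite word $y$ is $|y|/p$ where $p$ is the smallest period of $y$. A word avoids $3^+$-powers if every nonempty finite factor has exponent at most $3$. *)

(* Defs.v *)
From mathcomp Require Import all_boot all_order all_algebra.
From mathcomp Require Import all_classical all_reals all_analysis.
Set Implicit Arguments.
Unset Strict Implicit.
Unset Printing Implicit Defensive.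
Import Order.TTheory GRing.Theory Num.Theory.

Local Open Scope classical_set_scope.
Local Open Scope ring_scope.

Definition pseudoperiod1 (T : Type) (a : nat) (x : nat -> T) : Prop :=
  forall i : nat, x i = x i.+1 \/ x i = x (i + a)%N.

(* The bound p <= size y is not imposed; it holds automatically for the
   smallest period of a nonempty word. *)
Definition is_period (T : eqType) (y : seq T) (p : nat) : bool :=
  (0 < p)%N && [forall i : 'I_(size y - p), onth y i == onth y (i + p)%N].

Lemma is_period_ex (T : eqType) (y : seq T) : exists p, is_period y p.
Proof.
exists (size y).+1; rewrite /is_period /=; apply/forallP => -[i].
by rewrite subnS subnn.
Qed.

Definition smallest_period (T : eqType) (y : seq T) : nat :=
  ex_minn (is_period_ex y).

Definition word_exponent (T : eqType) (y : seq T) : rat :=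
  (size y)%:R / (smallest_period y)%:R.

Definition word_factor (T : Type) (x : nat -> T) (i n : nat) : seq T :=
  mkseq (fun k => x (i + k)%N) n.

Definition avoids_plus_powers (T : eqType) (e : rat) (x : nat -> T) : Prop :=
  forall i n : nat, (0 < n)%N -> word_exponent (word_factor x i n) <= e.

Definition admissible : set nat :=
  [set a | (3 <= a)%N /\
     exists x : nat -> bool, pseudoperiod1 a x /\ avoids_plus_powers 3 x].

Definition initial_count (A : set nat) (N : nat) : nat :=
  #|[pred a : 'I_N.+1 | (1 <= a)%N && `[< A a >]]|.

(* The value at N = 0 is 0 / 0 = 0, which does not affect the limit. *)
Definition lower_density (R : realType) (A : set nat) : \bar R :=
  limn_einf (fun N : nat => ((initial_count A N)%:R / N%:R : R)%:E).

(* Main.v *)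
Require Import Defs.
From Stdlib Require Import Ascii String.
From mathcomp Require Import all_boot all_order all_algebra.
From mathcomp Require Import all_classical all_reals all_analysis.
From mathcomp Require Import zify lra.

(** Fix a finite word [u] of length [k] over {0, 1, ?} whose first letter is the
    hole [?], repeat it forever, and fill the holes of the successive copies
    with the letters of the Thue-Morse word.  If every pair of consecutive
    letters that might differ, whatever the fillings, is compatible with the
    letter [r] places further on, then the filled word has pseudoperiod (1, a)
    for all a = r mod [k].  A factor of length 3p + 1 and period p is excluded by
    two definite letters of the periodic pattern that disagree when [k] does not
    divide p, and by the cube-freeness of the Thue-Morse word when it does.  Nine
    patterns of lengths 27 and 33 cover 255 of the 297 residues modulo 297,
    and 255 / 297 > 0.85. *)

Set Implicit Arguments.
Unset Strict Implicit.
Unset Printing Implicit Defensive.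
Import Order.TTheory GRing.Theory Num.Theory.

(** * The Thue-Morse word *)

(** Parity of the binary digit sum; fuel [n] suffices since halving a positive number decreases
    it. *)
Fixpoint thue_morse_rec (fuel n : nat) : bool :=
  if fuel is fuel'.+1 then odd n (+) thue_morse_rec fuel' n./2 else false.

Definition thue_morse (n : nat) : bool := thue_morse_rec n n.

Lemma thue_morse_recE f n : n <= f -> thue_morse_rec f n = thue_morse n.
Proof.
rewrite /thue_morse.
elim/ltn_ind: f n => -[|f] IH [|n] // le_nf /=.
  by have := IH f (ltnSn f) 0 (leq0n f).
by rewrite !IH //; lia.
Qed.

Lemma thue_morseE n : thue_morse n = odd n (+) thue_morse n./2.
Proof.
case: n => // n; rewrite {1}/thue_morse [LHS]/=.
by rewrite thue_morse_recE //; lia.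
Qed.

Lemma thue_morse_double n : thue_morse n.*2 = thue_morse n.
Proof. by rewrite thue_morseE odd_double doubleK. Qed.

Lemma thue_morse_doubleS n : thue_morse n.*2.+1 = ~~ thue_morse n.
Proof. by rewrite thue_morseE /= odd_double uphalf_double. Qed.

Definition has_cube (T : Type) (w : nat -> T) (m q : nat) : Prop :=
  forall t, t < q.*2 -> w (m + t) = w (m + t + q).

(** Three consecutive positions contain a pair [2l], [2l+1], whose letters differ. *)
Lemma thue_morse_no_run3 n :
  thue_morse n = thue_morse n.+1 -> thue_morse n.+1 = thue_morse n.+2 -> False.
Proof.
have [on|on] := boolP (~~ odd n).
  have -> : n = n./2.*2 by lia.
  by rewrite thue_morse_doubleS thue_morse_double; case: (thue_morse _).
have -> : n = n./2.*2.+1 by lia.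
rewrite -doubleS !thue_morse_doubleS thue_morse_double => _.
by case: (thue_morse _).
Qed.

(** Descent on [q]: if [q] is even, the letters at even positions form a cube of period [q./2]; if
    [q] is odd, a run of three equal letters appears. *)
Lemma thue_morse_cube_free m q : 0 < q -> ~ has_cube thue_morse m q.
Proof.
elim/ltn_ind: q m => q IH m q_gt0 cube.
have cubeE n : m <= n < m + q.*2 -> thue_morse n = thue_morse (n + q).
  by move=> ?; have := cube (n - m); rewrite subnKC; [apply; lia|lia].
have [oq|eq] := boolP (odd q); last first.
  apply: (IH q./2 _ (uphalf m)); [lia|lia|move=> t lt_t].
  rewrite -thue_morse_double cubeE; last lia.
  by rewrite -[RHS]thue_morse_double; congr thue_morse; lia.
have [q1|q_gt1] := leqP q 1.
  have q1' : q = 1 by lia.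
  move: cubeE; rewrite q1' => cubeE.
  apply: (@thue_morse_no_run3 m); rewrite (cubeE m, cubeE m.+1) ?addn1 //; lia.
(* An odd period moves a pair (2n, 2n+1), whose letters differ, onto a pair
   (2l+1, 2l+2), which forces the letters l and l+1 to agree; two such pairs give
   a run of length 3. *)
have step n : m <= n.*2 -> n.*2.+1 < m + q.*2 ->
    thue_morse (n + q./2) = thue_morse (n + q./2).+1.
  move=> le1 le2; have := thue_morse_doubleS n.
  rewrite -(thue_morse_double n) (cubeE n.*2) ?(cubeE n.*2.+1); try lia.
  have -> : n.*2 + q = (n + q./2).*2.+1 by lia.
  have -> : n.*2.+1 + q = (n + q./2).+1.*2 by lia.
  by rewrite thue_morse_doubleS thue_morse_double negbK.
(* Here [q >= 3], so the pairs for [n = uphalf m] and its successor both fit in the window. *)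
apply: (@thue_morse_no_run3 (uphalf m + q./2)); first by apply: step; lia.
by rewrite -addSn; apply: step; lia.
Qed.

(** * Patterns with holes *)

Section Pattern.
Variable u : seq (option bool).

Definition pattern_letter (i : nat) : option bool := nth None u (i %% size u).

Definition fill (w : nat -> bool) (i : nat) : bool :=
  odflt (w (i %/ size u)) (pattern_letter i).

Definition clash (o o' : option bool) : bool :=
  if (o, o') is (Some b, Some b') then b != b' else false.

(* Two steps of length p are needed since a single step may meet a hole. *)
Definition rigid_at (p i : nat) : bool :=
  has (fun j => clash (pattern_letter (i + j)) (pattern_letter (i + j + p)))
      (iota 0 p.*2.+1)
  || has (fun j => clash (pattern_letter (i + j)) (pattern_letter (i + j + p.*2)))
      (iota 0 p.+1).

Definition rigid : bool :=
  all (fun p => all (rigid_at p) (iota 0 (size u))) (iota 1 (size u).-1).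

(** A hole counts as either letter in the premise and as neither in the conclusion, so the test is
    valid for every filling. *)
Definition compatible_shift (r : nat) : bool :=
  all (fun i => all (fun b =>
      (pattern_letter i != Some (~~ b)) && (pattern_letter i.+1 != Some b)
      ==> (pattern_letter (i + r) == Some b)) [:: true; false])
    (iota 0 (size u)).

Hypothesis u_gt0 : 0 < size u.

Lemma pattern_letter_mod i j :
  i = j %[mod size u] -> pattern_letter i = pattern_letter j.
Proof. by rewrite /pattern_letter => ->. Qed.

Lemma fill_possible w i b : fill w i = b -> pattern_letter i != Some (~~ b).
Proof. by move=> <-; rewrite /fill; case: pattern_letter => //= -[]. Qed.

Lemma clash_fill w i j :
  clash (pattern_letter i) (pattern_letter j) -> fill w i <> fill w j.
Proof.
rewrite /fill; case: (pattern_letter i) => // b.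
by case: (pattern_letter j) => // b' /= /eqP.
Qed.

Lemma fill_pseudoperiod w a :
  compatible_shift (a %% size u) -> pseudoperiod1 a (fill w).
Proof.
move=> /allP compat i.
have [|neq] := eqVneq (fill w i) (fill w i.+1); first by left.
right; have /compat/allP/(_ (fill w i)) : i %% size u \in iota 0 (size u).
  by rewrite mem_iota /= ltn_mod.
rewrite (@pattern_letter_mod (i %% _) i) ?modn_mod //.
rewrite (@pattern_letter_mod (i %% _).+1 i.+1); last first.
  by rewrite -addn1 modnDml addn1.
rewrite (@pattern_letter_mod (i %% _ + _) (i + a)) ?modnDm //.
have -> : fill w i \in [:: true; false] by case: (fill w i).
have neqE : fill w i.+1 = ~~ fill w i by move: neq; do 2!case: (fill w _).
have := fill_possible neqE; rewrite negbK => ->.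
rewrite (fill_possible (erefl (fill w i))).
by move=> /(_ isT)/eqP eq_b; rewrite [in RHS]/fill eq_b.
Qed.

Lemma fill_overcube_free w p i : rigid -> nth None u 0 = None ->
  (forall m q, 0 < q -> ~ has_cube w m q) -> 0 < p ->
  ~ (forall j, j <= p.*2 -> fill w (i + j) = fill w (i + j + p)).
Proof.
set k := size u => rigid_u hole0 cube_free p_gt0 per.
have [/dvdnP[q pE]|ndvd] := boolP (k %| p).
  have q_gt0 : 0 < q by case: q pE p_gt0 => // ->.
  have hole n : fill w (n * k) = w n.
    by rewrite /fill /pattern_letter modnMl hole0 mulnK.
  (* The ceiling of [i / k]: [m * k] is the first multiple of [k] from [i] on. *)
  pose m := (i + k.-1) %/ k.
  have lem : i <= m * k by rewrite /m; have := divn_eq (i + k.-1) k;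
    have := ltn_pmod (i + k.-1) u_gt0; rewrite -/k; lia.
  have gem : m * k <= i + k.-1 by exact: leq_trunc_div.
  apply: (cube_free m q q_gt0) => t lt_t.
  have := per ((m + t) * k - i); rewrite subnKC; last by rewrite mulnDl; lia.
  rewrite pE -mulnDl !hole; apply.
  have : t.+1 * k <= q.*2 * k by rewrite leq_mul2r lt_t orbT.
  by rewrite -doubleMl mulSn mulnDl; lia.
(* Pattern letters see [p] only modulo [k], and [p' <= p] keeps the offsets of a clash within the
   range of [per]. *)
set p' := p %% k.
have p'_gt0 : 0 < p' by rewrite lt0n.
have p'_le : p' <= p by exact: leq_mod.
have /(allP rigid_u)/allP/(_ (i %% k)) : p' \in iota 1 k.-1.
  by rewrite mem_iota p'_gt0 add1n prednK // ltn_mod.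
rewrite mem_iota /= ltn_mod => /(_ u_gt0) /orP[] /hasP[j].
  rewrite mem_iota => /= lt_j.
  rewrite (@pattern_letter_mod (i %% k + j) (i + j)) ?modnDml //.
  rewrite (@pattern_letter_mod (i %% k + j + p') (i + j + p)); last first.
    by rewrite modnDmr -addnA modnDml addnA.
  by move=> /(@clash_fill w); apply; apply: per; lia.
rewrite mem_iota => /= lt_j.
rewrite (@pattern_letter_mod (i %% k + j) (i + j)) ?modnDml //.
rewrite (@pattern_letter_mod (i %% k + j + p'.*2) (i + j + p + p)); last first.
  by rewrite -addnn addnA modnDmr addnAC modnDmr -!addnA modnDml.
(* Since [j <= p' <= p], also [j + p <= p.*2], and [per] applies twice. *)
move=> /(@clash_fill w); apply; rewrite per; last lia.
by rewrite -addnA per ?addnA //; lia.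
Qed.

End Pattern.

(** A factor of exponent above 3 and smallest period [p] has at least [3p + 1] letters, hence gives
    [2p + 1] equalities. *)
Lemma avoids_plus_powers3 (T : eqType) (x : nat -> T) :
  (forall p i, 0 < p ->
     ~ (forall j, j <= p.*2 -> x (i + j) = x (i + j + p))) ->
  avoids_plus_powers 3 x.
Proof.
move=> no_power i n n_gt0; rewrite /word_exponent /smallest_period.
case: ex_minnP => p /andP[p_gt0 /forallP per] _.
rewrite ler_pdivrMr ?ltr0n // -natrM ler_nat size_mkseq leqNgt.
apply/negP => lt_n; apply: (no_power p i p_gt0) => j le_j.
have lt_j : j < size (word_factor x i n) - p by rewrite size_mkseq; lia.
have /eqP/(congr1 (odflt (x 0))) := per (Ordinal lt_j).
by rewrite !odflt_onth !nth_mkseq ?addnA //=; lia.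
Qed.

Lemma admissible_pattern (u : seq (option bool)) (a : nat) :
  0 < size u -> rigid u -> nth None u 0 = None ->
  compatible_shift u (a %% size u) -> 3 <= a -> admissible a.
Proof.
move=> u_gt0 rigid_u hole0 compat a_ge3; split=> //.
exists (fill u thue_morse); split; first exact: fill_pseudoperiod.
apply: avoids_plus_powers3 => p i p_gt0.
by apply: fill_overcube_free => // m q; exact: thue_morse_cube_free.
Qed.

(** * Lower density of unions of residue classes *)

Lemma card_ord_count (n : nat) (P : pred nat) :
  #|[pred a : 'I_n | P a]| = count P (iota 0 n).
Proof. by rewrite cardE size_filter -enumT -val_enum_ord count_map. Qed.

Lemma count_residues (M q : nat) (G : pred nat) :
  count (fun a => G (a %% M)) (iota 0 (q * M)) = q * count G (iota 0 M).
Proof.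
elim: q => [|q IH]; first by rewrite !mul0n.
rewrite mulSn [M + _]addnC iotaD count_cat IH add0n mulSn addnC; congr (_ + _).
rewrite -[X in iota X M]addn0 iotaDl count_map; apply: eq_in_count => a.
by rewrite mem_iota /= => lt_a; rewrite modnMDl modn_small.
Qed.

Lemma initial_count_residues (A : set nat) (M : nat) (G : pred nat) (N : nat) :
  ~~ G 0 -> (forall a, G (a %% M) -> A a) ->
  N %/ M * count G (iota 0 M) <= initial_count A N.
Proof.
move=> G0 GA; rewrite /initial_count.
rewrite (card_ord_count _ (fun a => (1 <= a) && `[< A a >])).
rewrite -count_residues.
have le_N : N %/ M * M <= N.+1 by rewrite (leq_trans (leq_trunc_div N M)).
rewrite -(subnKC le_N) iotaD count_cat; apply: leq_trans (leq_addr _ _).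
apply: sub_count => a Ga; apply/andP; split; last by apply/asboolP/GA.
by case: a Ga => //; rewrite mod0n (negbTE G0).
Qed.

Local Open Scope classical_set_scope.
Local Open Scope ring_scope.

Lemma limn_einf_ge_near (R : realType) (u : (\bar R)^nat) (l : \bar R) :
  (\forall n \near \oo, l <= u n)%E -> (l <= limn_einf u)%E.
Proof.
move=> [N _ le_u]; rewrite limn_einf_lim.
apply: lime_ge; first exact: is_cvg_einfs.
exists N => // n /= le_n; apply: le_ereal_inf_tmp => _ [m /= le_m <-].
by apply: le_u; exact: leq_trans le_n le_m.
Qed.

Lemma lower_density_residues (R : realType) (A : set nat) (M : nat)
    (G : pred nat) (l : R) :
  ~~ G 0%N -> (forall a, G (a %% M)%N -> A a) ->
  l * M%:R < (count G (iota 0 M))%:R -> (l%:E <= lower_density R A)%E.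
Proof.
move=> G0 GA; set c := count G _ => lt_l; apply: limn_einf_ge_near.
have M_gt0 : (0 < M)%N.
  by rewrite lt0n; apply/eqP => M0; move: lt_l; rewrite /c M0 mulr0 ltxx.
have d_gt0 : 0 < c%:R - l * M%:R by rewrite subr_gt0.
near=> N; rewrite lee_fin.
have N_gt0 : 0 < N%:R :> R by rewrite ltr0n; near: N; exact: nbhs_infty_gt.
(* This is [l * N <= (N / M - 1) * c] rearranged: the incomplete last block costs at most [c]. *)
have N_large : c%:R * M%:R <= N%:R * (c%:R - l * M%:R).
  by rewrite -ler_pdivrMr //; near: N; exact: nbhs_infty_ger.
rewrite ler_pdivlMr // -(ler_pM2r (_ : 0 < M%:R)) ?ltr0n //.
have le_count : (N %/ M * c)%:R <= (initial_count A N)%:R :> R.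
  by rewrite ler_nat; exact: initial_count_residues.
have le_N : (c * N)%:R <= (c * ((N %/ M).+1 * M))%:R :> R.
  by rewrite ler_nat leq_mul2l ltnW ?orbT // ltn_ceil.
have := ler_wpM2r (ler0n R M) le_count.
by rewrite !natrM -natr1 !mulrDl mul1r mulrDr in le_N *; lra.
Unshelve. all: by end_near. Qed.

(** * The nine patterns and the residues they cover *)

Definition pattern_of_string (s : string) : seq (option bool) :=
  [seq if Ascii.eqb c "?" then None else Some (Ascii.eqb c "1")
  | c <- list_ascii_of_string s].

(* Found by computer search among the patterns with a single hole. *)
Definition patterns : seq (seq (option bool)) := map pattern_of_string
  [:: "?00111000110001110011100011";
      "?00110011000110011100110011";
      "?00100110011001000110010011";
      "?00111000110001110001110011100011";
      "?01100110010001001100110110011001";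
      "?00110001100110001110011001110001";
      "?01001011010010010110110100101101";
      "?00100011001100111011000100111011";
      "?00100011001100010011001110111001"]%string.

(** Bounding the residue itself makes every member of its class at least 3, and excludes residue
    0. *)
Definition covered_residue (a : nat) : bool :=
  (3 <= a)%N && has (fun u => compatible_shift u (a %% size u)) patterns.

(** As 297 is the least common multiple of 27 and 33, a residue modulo 297 determines the one modulo
    each length. *)
Lemma patterns_rigid :
  all (fun u => [&& 0 < size u, size u %| 297, nth None u 0 == None & rigid u])%N
    patterns.
Proof. by vm_compute. Qed.

Lemma count_covered_residue : count covered_residue (iota 0 297) = 255%N.
Proof. by vm_compute. Qed.

Lemma covered_residue_admissible a : covered_residue (a %% 297) -> admissible a.
Proof.
move=> /andP[a_ge3 /hasP[u /(allP patterns_rigid)/and4P[u_gt0 dvd_u]]].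
move=> /eqP hole0 rigid_u.
rewrite modn_dvdm // => compat.
by apply: (@admissible_pattern u) => //; exact: leq_trans a_ge3 (leq_mod _ _).
Qed.

Local Close Scope ring_scope.
Local Close Scope classical_set_scope.

Theorem theorem34 (R : realType) :
  (((85%:R / 100%:R : R)%R)%:E <= lower_density R admissible)%E.
Proof.
apply: (lower_density_residues (M := 297) (G := covered_residue)) => //.
  exact: covered_residue_admissible.
rewrite count_covered_residue; lra.
Qed.
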